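(* (i) For $k\ge 2$ and $n\ge \max\{3k,4k-3\}$, $\mathrm{sat}(n,k\mathcal{C}_{\ge3})\le n+6k-7$. (ii) For $k\ge 2$ and $n\ge 4k-1$, $[n+6k-7,2n+2k-6]\subset \mathrm{ES}(n,k\mathcal{C}_{\ge3})$. (iii) For $k\ge 3$ and $n\ge 5k-1$, $[n+6k-7,3n-3k-3]\subset \mathrm{ES}(n,k\mathcal{C}_{\ge3})$. (iv) For $k\ge 5$ and $n\ge 5k-4$, $[2n+4k^2-24k+34,(2k-5)n-6k^2+21k-3]\subset \mathrm{ES}(n,k\mathcal{C}_{\ge3})$. (v) For $k\ge 2$ and $n\ge 3k$, $\{n-2k^2+k+(2k-2)t: t\in[3k,n]\}\subset \mathrm{ES}(n,k\mathcal{C}_{\ge3})$.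
   Context: All graphs are finite and simple. For integers $a\le b$, $[a,b]=\{a,\dots,b\}$. A graph $G$ is $k\mathcal{C}_{\ge3}$-saturated if it does not contain $k$ pairwise vertex-disjoint cycles, but for every pair of non-adjacent vertices $u,v$, $G+uv$ contains $k$ pairwise vertex-disjoint cycles. $\mathrm{sat}(n,k\mathcal{C}_{\ge3})$ is the minimum number of edges of an $n$-vertex $k\mathcal{C}_{\ge3}$-saturated graph, and $\mathrm{ES}(n,k\mathcal{C}_{\ge3})$ is the set of numbers of edges of all $n$-vertex $k\mathcal{C}_{\ge3}$-saturated graphs. *)

(* Defs.v *)
From HB Require Import structures.
From mathcomp Require Import all_boot all_order all_algebra.
From mathcomp Require Import boolp classical_sets set_interval.
Set Implicit Arguments.
Unset Strict Implicit.
Unset Printing Implicit Defensive.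
Local Open Scope nat_scope.

Record sgraph (T : finType) := SGraph {
  adj :> rel T;
  adj_sym : symmetric adj;
  adj_irr : irreflexive adj }.

Definition edges (T : finType) (G : sgraph T) : {set {set T}} :=
  [set [set p.1; p.2]%SET | p : T * T & adj G p.1 p.2]%SET.

Definition num_edges (T : finType) (G : sgraph T) : nat := #|edges G|.

(* The graph G + uv; it is G itself in the degenerate case u = v. *)
Definition add_edge_rel (T : finType) (G : sgraph T) (u v : T) : rel T :=
  [rel x y | adj G x y || (x != y) && ([set x; y] == [set u; v])%SET].

Lemma add_edge_sym (T : finType) (G : sgraph T) (u v : T) :
  symmetric (add_edge_rel G u v).
Proof. by move=> x y; rewrite /add_edge_rel /= adj_sym eq_sym finset.setUC. Qed.

Lemma add_edge_irr (T : finType) (G : sgraph T) (u v : T) :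
  irreflexive (add_edge_rel G u v).
Proof. by move=> x; rewrite /add_edge_rel /= adj_irr eqxx. Qed.

Definition add_edge (T : finType) (G : sgraph T) (u v : T) : sgraph T :=
  SGraph (add_edge_sym G u v) (add_edge_irr G u v).

Definition graph_cycle (T : finType) (G : sgraph T) (c : seq T) : Prop :=
  ucycle (adj G) c /\ 3 <= size c.

Definition has_disjoint_cycles (T : finType) (k : nat) (G : sgraph T) : Prop :=
  exists C : 'I_k -> seq T,
    (forall i, graph_cycle G (C i)) /\
    (forall i j, i != j -> [disjoint C i & C j]).

Definition saturated (T : finType) (k : nat) (G : sgraph T) : Prop :=
  ~ has_disjoint_cycles k G /\
  forall u v : T, u != v -> ~~ adj G u v ->
    has_disjoint_cycles k (add_edge G u v).

Definition ES (n k : nat) : set nat :=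
  [set m | exists G : sgraph 'I_n, saturated k G /\ num_edges G = m]%classic.

(* The default value 0 is irrelevant when 0 < k: see satP. *)
Definition sat (n k : nat) : nat :=
  xget 0 [set m | ES n k m /\ forall m', ES n k m' -> m <= m']%classic.

Definition no_edges (T : finType) : sgraph T :=
  @SGraph T (fun _ _ => false) (fun _ _ => erefl) (fun _ => erefl).

Lemma no_edgesN (T : finType) (k : nat) :
  0 < k -> ~ has_disjoint_cycles k (no_edges T).
Proof.
move=> k0 [C [/(_ (Ordinal k0)) [] + + _]].
by case: (C _) => [|x [|y s]] //= /andP[].
Qed.

Lemma ES_nonempty (n k : nat) : 0 < k -> exists m, ES n k m.
Proof.
move=> k0.
pose nadj (G : sgraph 'I_n) := #|[pred p : 'I_n * 'I_n | ~~ adj G p.1 p.2]|.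
suff main d (G : sgraph 'I_n) : nadj G <= d -> ~ has_disjoint_cycles k G ->
    exists H : sgraph 'I_n, saturated k H.
  have [H sH] := main _ _ (leqnn _) (@no_edgesN _ _ k0).
  by exists (num_edges H), H.
elim: d G => [|d IHd] G dG GN.
  exists G; split=> // u v _ Nuv.
  move: dG; rewrite leqn0 => /eqP/card0_eq /(_ (u, v)).
  by rewrite inE Nuv.
have [GS|] := pselect (saturated k G); first by exists G.
move=> /not_andP[//|] /existsNP[u] /existsNP[v].
move=> /not_implyP[uv] /not_implyP[Nuv HN].
apply: (IHd _ _ HN); rewrite -ltnS; apply: leq_trans dG.
apply/proper_card/properP; split.
  by apply/fintype.subsetP => -[x y]; rewrite !inE /= /add_edge_rel /= negb_or => /andP[].
by exists (u, v); rewrite !inE //= /add_edge_rel /= uv eqxx orbT.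
Qed.

Lemma satP (n k : nat) : 0 < k ->
  ES n k (sat n k) /\ forall m, ES n k m -> sat n k <= m.
Proof.
move=> /(@ES_nonempty n) [m0 Em0].
have ex : exists m, `[< ES n k m >] by exists m0; apply/asboolP.
rewrite /sat; case: xgetP => [m _ //|/(_ (ex_minn ex))[]].
case: ex_minnP => m /asboolP Em mP; split=> // m' Em'.
by apply: mP; apply/asboolP.
Qed.

(* Main.v *)
Require Import Defs.
From mathcomp Require Import all_boot all_order all_algebra.
From mathcomp Require Import boolp classical_sets set_interval.
From mathcomp Require Import zify.
Import Order.TTheory GRing.Theory Num.Theory.
Set Implicit Arguments.
Unset Strict Implicit.
Unset Printing Implicit Defensive.

(** Saturated graphs are built by gluing rooted graphs at their roots. A rooted
    graph with packing number f is "good" if adding any edge raises the packing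
    number to f + 1 and every vertex can be joined to the root by a path that
    misses some f disjoint cycles. Gluing good graphs at their roots adds the
    packing numbers and the numbers of edges: a cycle of the glued graph lies on
    one side, and a new edge between the two sides closes a cycle through the
    root which leaves all f1 + f2 old cycles alive. The blocks are K_2 (pendant
    edges), K_5, the join of K_{2f+1} with independent vertices, and a wheel
    with rim C_5 whose hub is universal and to which vertices of degree 2 are
    attached; the last block supplies every parity. *)

(** * Cycle packings *)

(** A single [uniq] on the concatenation says both that no cycle repeats a vertex and that the
    cycles are pairwise disjoint. *)
Definition packing (T : eqType) (e : rel T) (L : seq (seq T)) :=
  all (fun c => cycle e c && (2 < size c)) L && uniq (flatten L).

(** Unlike [add_edge_rel], this needs no finite type and compares vertices instead of two-element
    sets, so it is easily carried along maps. *)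
Definition addrel (T : eqType) (e : rel T) (u v : T) : rel T :=
  fun x y => [|| e x y, (x == u) && (y == v) | (x == v) && (y == u)].

Lemma sub_packing (T : eqType) (e e' : rel T) L :
  subrel e e' -> packing e L -> packing e' L.
Proof.
move=> ee' /andP[Lc Lu]; apply/andP; split=> //.
by apply: sub_all Lc => c /andP[/(sub_cycle ee') -> ->].
Qed.

Lemma packing_map (T T' : eqType) (e : rel T) (e' : rel T') (h : T -> T') L :
  injective h -> {mono h : x y / e x y >-> e' x y} ->
  packing e' (map (map h) L) = packing e L.
Proof.
move=> hI eh; rewrite /packing -map_flatten map_inj_uniq // all_map.
by congr (_ && _); apply: eq_all => c /=; rewrite (mono_cycle eh) size_map.
Qed.

Lemma packing_map_hom (T T' : eqType) (e : rel T) (e' : rel T') (h : T -> T') L :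
  injective h -> {homo h : x y / e x y >-> e' x y} ->
  packing e L -> packing e' (map (map h) L).
Proof.
move=> hI eh Lp; rewrite (packing_map (e := relpre h e')) //.
exact: sub_packing Lp.
Qed.

Lemma addrel_hom (T T' : eqType) (e : rel T) (e' : rel T') (h : T -> T') u v :
  {homo h : x y / e x y >-> e' x y} ->
  {homo h : x y / addrel e u v x y >-> addrel e' (h u) (h v) x y}.
Proof.
move=> eh x y /or3P[/eh exy|/andP[/eqP-> /eqP->]|/andP[/eqP-> /eqP->]];
  by rewrite /addrel ?exy ?eqxx ?orbT.
Qed.

Lemma packing_cat (T : eqType) (e : rel T) L1 L2 :
  packing e (L1 ++ L2) =
  [&& packing e L1, packing e L2 & ~~ has (mem (flatten L1)) (flatten L2)].
Proof.
rewrite /packing all_cat flatten_cat cat_uniq.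
by case: (all _ L1); case: (all _ L2); case: (uniq (flatten L1));
  case: (uniq (flatten L2)); rewrite ?andbF ?andbT.
Qed.

Lemma packing_cons (T : eqType) (e : rel T) c L :
  packing e (c :: L) =
  [&& cycle e c, 2 < size c, uniq (c ++ flatten L) & packing e L].
Proof.
rewrite /packing /= cat_uniq.
by case: cycle; case: (2 < size c); case: all; case: (uniq (flatten L));
  rewrite ?andbF ?andbT.
Qed.

Lemma uniq_flatten_disjoint (T : eqType) (L : seq (seq T)) i j :
  uniq (flatten L) -> i < j -> j < size L ->
  ~~ has (mem (nth [::] L i)) (nth [::] L j).
Proof.
elim: L i j => [|c L IH] [|i] [|j] //=; rewrite cat_uniq => /and3P[_ cL Lu].
  move=> _ jL; apply: contra cL => /hasP[x xj xc]; apply/hasP; exists x => //.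
  by apply/flattenP; exists (nth [::] L j) => //; rewrite mem_nth.
by rewrite !ltnS; apply: IH.
Qed.

Lemma flatten_uniq (T : eqType) (L : seq (seq T)) c :
  uniq (flatten L) -> c \in L -> uniq c.
Proof.
elim: L => //= d L IH; rewrite cat_uniq inE => /and3P[du _ /IH cu].
by case/orP=> [/eqP->|].
Qed.

Lemma has_disjoint_cyclesP (T : finType) k (G : sgraph T) :
  has_disjoint_cycles k G <-> exists2 L, packing (adj G) L & size L = k.
Proof.
split=> [[C [Cc Cd]]|[L /andP[Lc Lu] sL]].
  exists (map C (enum 'I_k)); last by rewrite size_map size_enum_ord.
  apply/andP; split.
    by apply/allP => _ /mapP[i _ ->]; have [/andP[-> _] ->] := Cc i.
  elim: (enum _) (enum_uniq 'I_k) => //= i s IH /andP[is_ /IH su].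
  have [/andP[_ iu] _] := Cc i; rewrite cat_uniq iu su andbT /=.
  apply/hasPn => x /flattenP[_ /mapP[j js ->]] xj.
  have ij : j != i by apply: contraNneq is_ => <-.
  by have /disjointFr/(_ xj) := Cd _ _ ij => /= ->.
exists (fun i => nth [::] L i); split=> [i|i j].
  have iL : i < size L by rewrite sL.
  have /andP[ci s3] := allP Lc _ (mem_nth [::] iL).
  split=> //; apply/andP; split=> //.
  exact: flatten_uniq Lu (mem_nth [::] iL).
move=> ij; wlog lt_ij : i j ij / i < j.
  move=> W; have [/W->//|ji|/ord_inj eij] := ltngtP i j.
    by rewrite disjoint_sym; apply: W => //; rewrite eq_sym.
  by rewrite eij eqxx in ij.
rewrite disjoint_sym disjoint_has.
by apply: uniq_flatten_disjoint; rewrite ?sL.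
Qed.

Lemma handshake (T : finType) (G : sgraph T) :
  \sum_x \sum_y adj G x y = (num_edges G).*2.
Proof.
rewrite pair_big /= -(big_mkcond (fun p => adj G p.1 p.2) (fun=> 1)) /=.
pose A := [set p : T * T | adj G p.1 p.2]%SET.
pose h (p : T * T) := [set p.1; p.2]%SET.
rewrite (eq_bigl [in A]); last by move=> p; rewrite inE.
(* Ordered adjacent pairs are grouped by the edge they span; each edge comes from exactly two of
   them. *)
rewrite (partition_big_imset h) /=.
rewrite (eq_bigr (fun=> 2)).
  by rewrite sum_nat_const muln2.
move=> _ /imsetP[[x y] /[!inE] /= xy ->].
have nxy : x != y by apply: contraTneq xy => ->; rewrite adj_irr.
rewrite sum1dep_card -(_ : #|[set (x, y); (y, x)]%SET| = 2).
  apply: eq_card => -[a b]; rewrite !inE /h /= !xpair_eqE.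
  apply/andP/orP => [[ab /eqP E]|[]/andP[/eqP-> /eqP->]]; rewrite ?xy ?eqxx //.
    have : a \in [set x; y]%SET by rewrite -E !inE eqxx.
    have : b \in [set x; y]%SET by rewrite -E !inE eqxx orbT.
    rewrite !inE; move: ab; case: (eqVneq a x) => [->|_] /= ab.
      by case: (eqVneq b x) ab => [->|_ _ /= -> _]; [rewrite adj_irr|left].
    case: (eqVneq b y) ab => [->|_] ab /=; last by rewrite orbF => -> ->; right.
    by move=> _ /eqP ay; rewrite ay adj_irr in ab.
  by rewrite adj_sym xy finset.setUC.
by rewrite cards2 xpair_eqE negb_and nxy.
Qed.

(** * Gluing at the root *)

Lemma packing_perm (T : eqType) (e : rel T) L L' :
  perm_eq L L' -> packing e L = packing e L'.
Proof.
by move=> LL'; rewrite /packing (perm_all _ LL') (perm_uniq (perm_flatten LL')).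
Qed.

Lemma addrelC (T : eqType) (e : rel T) u v : addrel e u v =2 addrel e v u.
Proof. by move=> x y; rewrite /addrel [X in _ || X]orbC. Qed.

Lemma sub_addrel (T : eqType) (e : rel T) u v : subrel e (addrel e u v).
Proof. by move=> x y; rewrite /addrel => ->. Qed.

(* The vertices are [option T], with the root [None]. *)
Record good (T : finType) (f : nat) (e : rel (option T)) : Prop := Good {
  good_sym : symmetric e;
  good_irr : irreflexive e;
  good_le : forall L, packing e L -> size L <= f;
  good_add : forall u v, u != v -> ~~ e u v ->
    exists2 L, packing (addrel e u v) L & size L = f.+1;
  good_path : forall u, exists p L, [/\ path e None p, last None p = u,
    packing e L, uniq (None :: p ++ flatten L) & size L = f] }.

(** The case [u = None] of [good_path]: the packing there is disjoint from a path that starts at the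
    root. *)
Lemma good_avoid_root (T : finType) f (e : rel (option T)) : good f e ->
  exists L, [/\ packing e L, None \notin flatten L & size L = f].
Proof.
case=> _ _ _ _ /(_ None)[p [L [_ _ Lp /= /andP[+ _] sL]]].
by rewrite mem_cat negb_or => /andP[_ NL]; exists L.
Qed.

(** Only two embeddings that meet in the root are recorded, so the two sides can be exchanged and
    each argument is given for one side only. *)
Record wedge (T1 T2 : finType) (V : eqType) (e1 : rel (option T1))
    (e2 : rel (option T2)) (e : rel V) i1 i2 : Prop := Wedge {
  wedge_inj1 : injective i1;
  wedge_inj2 : injective i2;
  wedge_mono1 : {mono i1 : x y / e1 x y >-> e x y};
  wedge_mono2 : {mono i2 : x y / e2 x y >-> e x y};
  wedge_root : i1 None = i2 None;
  wedge_meet : forall x y, i1 x = i2 y -> x = None /\ y = None }.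

Lemma wedge_swap (T1 T2 : finType) (V : eqType) (e1 : rel (option T1))
    (e2 : rel (option T2)) (e : rel V) i1 i2 :
  wedge e1 e2 e i1 i2 -> wedge e2 e1 e i2 i1.
Proof. by case=> ? ? ? ? ? m; split=> // x y /esym/m[]. Qed.

Section Wedge.
Variables (T1 T2 : finType) (V : eqType) (f1 f2 : nat).
Variables (e1 : rel (option T1)) (e2 : rel (option T2)) (e : rel V).
Variables (i1 : option T1 -> V) (i2 : option T2 -> V).
Hypotheses (W : wedge e1 e2 e i1 i2) (G1 : good f1 e1) (G2 : good f2 e2).

Lemma wedge_disjoint A B : None \notin B ->
  ~~ has (mem (map i1 A)) (map i2 B).
Proof.
move=> NB; apply/hasPn => _ /mapP[y yB ->]; apply/mapP => -[x xA /esym].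
by case/(wedge_meet W) => _ y0; rewrite -y0 yB in NB.
Qed.

(** The packing gained on the first side may use the root, so the second side contributes a packing
    that misses it. *)
Lemma wedge_add_same u v : u != v -> ~~ e1 u v ->
  exists2 L, packing (addrel e (i1 u) (i1 v)) L & size L = (f1 + f2).+1.
Proof.
move=> uv Nuv; have [L1 L1p s1] := good_add G1 uv Nuv.
have [L2 [L2p NL2 s2]] := good_avoid_root G2.
exists (map (map i1) L1 ++ map (map i2) L2); last by rewrite size_cat !size_map s1 s2.
rewrite packing_cat -!map_flatten wedge_disjoint // andbT; apply/andP; split.
  apply: packing_map_hom L1p; first exact: wedge_inj1 W.
  by apply: addrel_hom => x y; rewrite (wedge_mono1 W).
apply: sub_packing (@sub_addrel _ _ _ _) _.
by rewrite (packing_map _ (wedge_inj2 W) (wedge_mono2 W)).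
Qed.

Lemma wedge_path u : exists p L, [/\ path e (i1 None) p, last (i1 None) p = i1 u,
  packing e L, uniq (i1 None :: p ++ flatten L) & size L = f1 + f2].
Proof.
have [p [L1 [pp lp L1p pu s1]]] := good_path G1 u.
have [L2 [L2p NL2 s2]] := good_avoid_root G2.
exists (map i1 p), (map (map i1) L1 ++ map (map i2) L2); split.
- by rewrite (mono_path (wedge_mono1 W)).
- by rewrite last_map lp.
- rewrite packing_cat -!map_flatten wedge_disjoint // andbT.
  by rewrite !(packing_map _ (wedge_inj1 W) (wedge_mono1 W))
    !(packing_map _ (wedge_inj2 W) (wedge_mono2 W)) L1p.
- rewrite flatten_cat catA -!map_flatten -map_cat -cat_cons -map_cons.
  rewrite cat_uniq wedge_disjoint // !map_inj_uniq ?pu //=.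
  + by case/andP: L2p.
  + exact: wedge_inj2 W.
  + exact: wedge_inj1 W.
- by rewrite size_cat !size_map s1 s2.
Qed.

(** The root paths to [u] and [v] close up through the new edge, and each of them spares a full
    packing of its own side. *)
Lemma wedge_add_across u v : u != None -> v != None -> symmetric e ->
  exists2 L, packing (addrel e (i1 u) (i2 v)) L & size L = (f1 + f2).+1.
Proof.
move=> u0 v0 e_sym.
have [p1 [L1 [pp1 lp1 L1p pu1 s1]]] := good_path G1 u.
have [p2 [L2 [pp2 lp2 L2p /= /andP[] + pu2 s2]]] := good_path G2 v.
move=> Np2; set e' := addrel _ _ _; have ee' : subrel e e' := @sub_addrel _ _ _ _.
(* The cycle runs from the root to [u], crosses the new edge to [v] and returns along the reversed
   second path. *)
exists ((i1 None :: map i1 p1 ++ rev (map i2 p2)) ::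
    (map (map i1) L1 ++ map (map i2) L2)); last by rewrite /= size_cat !size_map s1 s2.
have sp1 : 0 < size p1 by case: p1 lp1 u0 {pp1 pu1} => //= <-.
case/lastP: p2 pp2 lp2 pu2 Np2 => [|q w]; first by move=> _ /= v1; rewrite -v1 in v0.
rewrite last_rcons => pp2 wv; rewrite {w}wv in pp2 * => pu2 Np2.
rewrite packing_cons; apply/and4P; split.
- rewrite /= rcons_cat cat_path (sub_path ee') ?(mono_path (wedge_mono1 W)) //=.
  rewrite last_map lp1 map_rcons rev_rcons /= {1}/e' /addrel !eqxx orbT /=.
  rewrite (sub_path ee') // (wedge_root W).
  have := rev_path e (i2 None) (rcons (map i2 q) (i2 v)).
  rewrite last_rcons belast_rcons rev_cons => ->.
  rewrite (eq_path (e' := e)) -?map_rcons ?(mono_path (wedge_mono2 W)) //.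
- rewrite /= size_cat size_rev !size_map size_rcons; lia.
(* Reordering separates the two sides; the root is listed on the first side only. *)
- rewrite (@perm_uniq _ _ (map i1 (None :: p1 ++ flatten L1) ++
      map i2 (rcons q v ++ flatten L2))).
    rewrite cat_uniq wedge_disjoint // !map_inj_uniq ?pu1 ?pu2 //.
      exact: wedge_inj2 W.
    exact: wedge_inj1 W.
  apply/permP => a; rewrite /= flatten_cat !map_cat !count_cat count_rev -!map_flatten.
  lia.
- rewrite packing_cat -!map_flatten wedge_disjoint ?andbT.
    rewrite !(sub_packing ee') //.
      by rewrite (packing_map _ (wedge_inj2 W) (wedge_mono2 W)).
    by rewrite (packing_map _ (wedge_inj1 W) (wedge_mono1 W)).
  by apply: contra Np2; rewrite mem_cat => ->; rewrite orbT.
Qed.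
End Wedge.

(** This lets the cycles on one side of a glued graph be counted by the packing number of that
    side. *)
Lemma packing_onto (T V : eqType) (e : rel T) (e' : rel V) (h : T -> V)
    (L : seq (seq V)) :
  injective h -> {mono h : x y / e x y >-> e' x y} ->
  (forall c x, c \in L -> x \in c -> exists y, x = h y) -> packing e' L ->
  exists2 L', packing e L' & size L' = size L.
Proof.
move=> hI eh hL Lp.
suff [L' eL'] : exists L', L = map (map h) L'.
  by exists L'; [rewrite eL' (packing_map L' hI eh) in Lp|rewrite eL' size_map].
elim: L hL {Lp} => [|c L IH] hL; first by exists [::].
have [|L' ->] := IH; first by move=> c' x c'L; apply: hL; rewrite inE c'L orbT.
suff [c' ->] : exists c', c = map h c' by exists (c' :: L').
have {hL} : forall x, x \in c -> exists y, x = h y.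
  by move=> x; apply: hL; rewrite mem_head.
elim: c => [|x c IHc] hc; first by exists [::].
have [|c' ->] := IHc; first by move=> z zc; apply: hc; rewrite inE zc orbT.
by have [y ->] := hc x (mem_head _ _); exists (y :: c').
Qed.

Section Glue.
Variables (T1 T2 : finType) (e1 : rel (option T1)) (e2 : rel (option T2)).

Definition glue : rel (option (T1 + T2)) := fun x y =>
  match x, y with
  | Some (inl a), Some (inl b) => e1 (Some a) (Some b)
  | Some (inl a), None => e1 (Some a) None
  | None, Some (inl b) => e1 None (Some b)
  | Some (inr a), Some (inr b) => e2 (Some a) (Some b)
  | Some (inr a), None => e2 (Some a) None
  | None, Some (inr b) => e2 None (Some b)
  | _, _ => false
  end.

(** The root counts as lying on both sides. *)
Definition on_left (x : option (T1 + T2)) := if x is Some (inr _) then false else true.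
Definition on_right (x : option (T1 + T2)) := if x is Some (inl _) then false else true.

Lemma glue_path_side x p : path glue x p -> None \notin x :: p ->
  all on_left (x :: p) || all on_right (x :: p).
Proof.
elim: p x => [|y p IH] x /=; first by case: x => [[]|].
case/andP=> xy yp; rewrite inE negb_or => /andP[Nx Nyp].
have := IH _ yp Nyp; move: xy Nx Nyp; rewrite inE negb_or.
by case: x => [[a|a]|] //; case: y {yp} => [[b|b]|].
Qed.

(** Only the root links the sides, and a cycle passes it at most once: rotated to start there, the
    cycle continues as a path that avoids the root. *)
Lemma glue_cycle_side c : cycle glue c -> uniq c ->
  all on_left c || all on_right c.
Proof.
have [/rot_to[i q rq]|] := boolP (None \in c); last first.
  case: c => //= x p Np; rewrite rcons_path => /andP[xp _] _.
  exact: glue_path_side.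
rewrite -(rot_cycle i) -(rot_uniq i) -2!(perm_all _ (permEl (perm_rot i c))) rq /=.
case: q {rq} => //= y q; rewrite rcons_path => /and3P[_ yq _] /andP[Nq _].
exact: (glue_path_side yq Nq).
Qed.

Lemma glue_good f1 f2 : good f1 e1 -> good f2 e2 -> good (f1 + f2) glue.
Proof.
move=> G1 G2.
have W : wedge e1 e2 glue (omap inl) (omap inr).
  split=> //; [by move=> [x|] [y|] //= [->]|by move=> [x|] [y|] //= [->]| | |].
  - by move=> [x|] [y|] //=; rewrite (good_irr G1).
  - by move=> [x|] [y|] //=; rewrite (good_irr G2).
  - by move=> [x|] [y|].
have s_glue : symmetric glue.
  by move=> [[x|x]|] [[y|y]|] //=;
    first [exact: (good_sym G1)|exact: (good_sym G2)].
split=> //; first by move=> [[x|x]|] //=; rewrite ?(good_irr G1) ?(good_irr G2).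
- move=> L Lp.
  (* The cycles inside the left side number at most [f1]; all others lie on the right and number at
     most [f2]. *)
  have := Lp; rewrite -(packing_perm _ (permEl (perm_filterC (all on_left) L))).
  rewrite packing_cat => /and3P[LA LB _].
  rewrite -(count_predC (all on_left) L) -!size_filter leq_add //.
    have [c x|A' Ap <-] := packing_onto (wedge_inj1 W) (wedge_mono1 W) _ LA.
      rewrite mem_filter => /andP[/allP cL _] /cL.
      by case: x => [[a|]|] // _; [exists (Some a)|exists None].
    exact: good_le G1 _ Ap.
  have [c x|B' Bp <-] := packing_onto (wedge_inj2 W) (wedge_mono2 W) _ LB.
    rewrite mem_filter => /andP[/= NcL cL].
    case/andP: Lp => /allP/(_ _ cL)/andP[cc _] /flatten_uniq Lu.
    have := glue_cycle_side cc (Lu _ cL); rewrite (negPf NcL) => /allP/(_ x) cR /cR.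
    by case: x {cR} => [[|a]|] // _; [exists (Some a)|exists None].
  exact: good_le G2 _ Bp.
- move=> u v uv Nuv; have W' := wedge_swap W.
  have left_case a b : omap inl a != omap inl b :> option (T1 + T2) ->
      ~~ glue (omap inl a) (omap inl b) ->
    exists2 L, packing (addrel glue (omap inl a) (omap inl b)) L &
      size L = (f1 + f2).+1.
    move=> ab; rewrite (wedge_mono1 W); apply: (wedge_add_same W G1 G2).
    by apply: contraNneq ab => ->.
  have right_case a b : omap inr a != omap inr b :> option (T1 + T2) ->
      ~~ glue (omap inr a) (omap inr b) ->
    exists2 L, packing (addrel glue (omap inr a) (omap inr b)) L &
      size L = (f1 + f2).+1.
    move=> ab; rewrite (wedge_mono2 W) addnC; apply: (wedge_add_same W' G2 G1).
    by apply: contraNneq ab => ->.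
  case: u v uv Nuv => [[a|a]|] [[b|b]|] uv Nuv.
  + exact: (left_case (Some a) (Some b)).
  + exact: (wedge_add_across W G1 G2 (u := Some a) (v := Some b)).
  + exact: (left_case (Some a) None).
  + by rewrite addnC; apply: (wedge_add_across W' G2 G1 (u := Some a) (v := Some b)).
  + exact: (right_case (Some a) (Some b)).
  + exact: (right_case (Some a) None).
  + exact: (left_case None (Some b)).
  + exact: (right_case None (Some b)).
  + by rewrite eqxx in uv.
- case=> [[a|a]|].
  + exact: (wedge_path W G1 G2 (Some a)).
  + by rewrite addnC; apply: (wedge_path (wedge_swap W) G2 G1 (Some a)).
  + exact: (wedge_path W G1 G2 None).
Qed.

Lemma big_option (T : finType) (F : option T -> nat) :
  \sum_x F x = F None + \sum_x F (Some x).
Proof.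
rewrite (bigD1 None) //=; congr (_ + _).
rewrite (reindex_omap Some id) => [|[]//].
by apply: eq_bigl => x; rewrite eqxx.
Qed.

(** The rows and columns of the two roots are merged; irreflexivity makes the entries at the root
    pair vanish on both sides. *)
Lemma glue_sum : irreflexive e1 -> irreflexive e2 ->
  \sum_x \sum_y glue x y = \sum_x \sum_y e1 x y + \sum_x \sum_y e2 x y.
Proof.
move=> r1 r2; rewrite !big_option !big_sumType /= r1 r2.
under [X in _ + (X + _)]eq_bigr => i _ do rewrite big_option big_sumType /= big1_eq addn0.
under [X in _ + (_ + X)]eq_bigr => i _ do rewrite big_option big_sumType /= big1_eq add0n.
under [X in _ = _ + X + _]eq_bigr => i _ do rewrite big_option.
under [X in _ = _ + (_ + X)]eq_bigr => i _ do rewrite big_option.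
rewrite !big_split /=; lia.
Qed.
End Glue.

(* [N] does not count the root. *)
Definition realizable f N m :=
  exists (T : finType) (e : rel (option T)),
    [/\ #|T| = N, good f e & \sum_x \sum_y e x y = m.*2].

Lemma realizable_add f1 N1 m1 f2 N2 m2 :
  realizable f1 N1 m1 -> realizable f2 N2 m2 ->
  realizable (f1 + f2) (N1 + N2) (m1 + m2).
Proof.
move=> [T1 [e1 [<- G1 E1]]] [T2 [e2 [<- G2 E2]]].
exists (T1 + T2)%type, (glue e1 e2); split.
- by rewrite card_sum.
- exact: glue_good.
- by rewrite glue_sum ?E1 ?E2 ?doubleD //; [apply: good_irr G1|apply: good_irr G2].
Qed.

(** The root is the extra vertex, and packing number [f] is the threshold for [f.+1] disjoint
    cycles. An enumeration of the vertices transports the graph to an ordinal. *)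
Lemma realizable_ES f N m : realizable f N m -> ES N.+1 f.+1 m.
Proof.
move=> [T [e [<- G E]]]; rewrite -card_option.
pose h := @enum_val (option T) predT.
have hB : bijective h := enum_val_bij _.
have hI : injective h := bij_inj hB.
have [g gK hK] := hB.
have gI : injective g := can_inj hK.
have Gs : symmetric (relpre h e) by move=> x y /=; apply: good_sym G _ _.
have Gi : irreflexive (relpre h e) by move=> x /=; apply: good_irr G _.
pose H := SGraph Gs Gi.
have geH : {homo g : x y / e x y >-> H x y} by move=> x y; rewrite /= !hK.
exists H; split; last first.
  apply: double_inj; rewrite -handshake -E (reindex h) /=; last exact: onW_bij.
  by apply: eq_bigr => x _; rewrite (reindex h) //=; exact: onW_bij.
split=> [/has_disjoint_cyclesP[L Lp sL]|u v uv Nuv].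
  have := good_le G (packing_map_hom (e' := e) hI _ Lp).
  by rewrite size_map sL ltnn => /(_ (fun _ _ => id)).
have hN : h u != h v by rewrite (inj_eq hI).
have [L Lp sL] := good_add G hN Nuv.
apply/has_disjoint_cyclesP; exists (map (map g) L); last by rewrite size_map.
apply: packing_map_hom gI _ Lp.
move=> x y; rewrite /= /add_edge_rel /=.
case/or3P=> [xy|/andP[/eqP-> /eqP->]|/andP[/eqP-> /eqP->]].
- by rewrite !hK xy.
- by rewrite !gK uv eqxx orbT.
- by rewrite !gK eq_sym uv finset.setUC eqxx orbT.
Qed.

(** * Cliques and their joins with independent sets *)

Lemma packing1 (T : eqType) (e : rel T) c :
  packing e [:: c] = [&& cycle e c, 2 < size c & uniq c].
Proof. by rewrite packing_cons /packing /= cats0 andbT. Qed.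

Lemma packing_size (T : finType) (e : rel T) L : packing e L -> size L <= #|T| %/ 3.
Proof.
rewrite leq_divRL // mulnC.
case/andP=> Lc /card_uniqP Lu; apply: leq_trans (max_card (mem (flatten L))).
rewrite Lu {Lu}.
by elim: L Lc => //= c L IH /andP[/andP[_ c3] /IH]; rewrite size_cat; lia.
Qed.

Lemma packing_edge (T : eqType) (e : rel T) u v p L :
  path e v (rcons p u) -> 0 < size p -> packing e L ->
  uniq (u :: v :: p ++ flatten L) ->
  packing (addrel e u v) ((u :: v :: p) :: L).
Proof.
move=> vp p0 Lp Lu; rewrite packing_cons; apply/and4P; split=> //.
- by rewrite /= {1}/addrel !eqxx orbT (sub_path _ vp) //; apply: sub_addrel.
- exact: sub_packing (@sub_addrel _ _ _ _) Lp.
Qed.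

Lemma sum_neq (T : finType) (x : T) : \sum_y (x != y) = #|T|.-1.
Proof.
rewrite -(cardC1 x) -sum1_card [RHS]big_mkcond /=.
by apply: eq_bigr => y _; rewrite inE eq_sym; case: eqP.
Qed.

Lemma realizable_K2 : realizable 0 1 1.
Proof.
exists unit, (fun x y => x != y); split; first exact: card_unit.
  split=> //.
  - by move=> x y; rewrite eq_sym.
  - by move=> x; rewrite eqxx.
  - by move=> L /packing_size; rewrite card_option card_unit.
  - by move=> u v ->.
  - by move=> [[]|]; [exists [:: Some tt], [::]|exists [::], [::]].
under eq_bigr => x _ do rewrite sum_neq card_option card_unit.
by rewrite sum_nat_const card_option card_unit.
Qed.

(** Five vertices cannot hold two disjoint cycles. The block brings six edges more than four pendant
    edges would. *)
Lemma realizable_K5 : realizable 1 4 10.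
Proof.
pose T := (bool * bool)%type; have T4 : #|{: T}| = 4 by rewrite card_prod card_bool.
exists T, (fun x y => x != y); split=> //; last first.
  under eq_bigr => x _ do rewrite sum_neq card_option T4.
  by rewrite sum_nat_const card_option T4.
split.
- by move=> x y; rewrite eq_sym.
- by move=> x; rewrite eqxx.
- by move=> L /packing_size; rewrite card_option T4.
- by move=> u v ->.
- case=> [[a b]|].
    (* The three vertices other than the root and the target form the spared triangle. *)
    exists [:: Some (a, b)],
      [:: [:: Some (~~ a, b); Some (a, ~~ b); Some (~~ a, ~~ b)]].
    by case: a b => [] [].
  by exists [::],
    [:: [:: Some (true, true); Some (true, false); Some (false, true)]].
Qed.

Section CliqueJoin.
Variables (f c m : nat).
Hypothesis cE : c = f.*2.+1.
Let V := option ('I_c + 'I_m).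

Definition in_clique (x : V) := if x is Some (inl _) then true else false.

(* The root is one of the [m.+1] independent vertices. The clique size has its
   own name [c] so that rewriting [f.*2.+1] does not touch the vertex type. *)
Definition clique_join : rel V := fun x y => (x != y) && (in_clique x || in_clique y).

Lemma clique_join_sum :
  \sum_x \sum_y clique_join x y = (c * (f + m.+1)).*2.
Proof.
have clq i : \sum_y clique_join (Some (inl i)) y = c + m.
  rewrite (eq_bigr (fun y => (Some (inl i) != y) : nat)) => [|y _].
    by rewrite sum_neq card_option card_sum !card_ord.
  by rewrite /clique_join andbT.
have indep x : ~~ in_clique x -> \sum_y clique_join x y = c.
  move=> xN; rewrite big_option big_sumType /clique_join /= (negPf xN) andbF add0n.
  rewrite [X in _ + X]big1 ?addn0 => [|i _]; last by rewrite andbF.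
  rewrite (eq_bigr (fun=> 1)) => [|i _]; first by rewrite sum_nat_const card_ord muln1.
  by rewrite andbT; case: eqP xN => [->|].
rewrite big_option big_sumType (indep None) // (eq_bigr _ (fun i _ => clq i)).
rewrite (eq_bigr _ (fun i _ => indep (Some (inr i)) isT)).
rewrite !sum_nat_const !card_ord /=; lia.
Qed.

(** Every edge has an end in the clique, so every cycle uses at least two of the [f.*2.+1] clique
    vertices. *)
Lemma clique_join_le L : packing clique_join L -> size L <= f.
Proof.
case/andP=> Lc Lu.
suff : (size L).*2 <= c by move: (size L) => a; lia.
pose K : seq V := [seq Some (inl i) | i <- enum 'I_c].
have sK : size K = c by rewrite size_map size_enum_ord.
have : size (filter in_clique (flatten L)) <= size K.
  apply: uniq_leq_size; first exact: filter_uniq.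
  move=> [[i|j]|]; rewrite mem_filter //= => _.
  by apply/mapP; exists i; rewrite ?mem_enum.
rewrite sK; apply: leq_trans.
rewrite size_filter; elim: L Lc Lu => //= q L IH /andP[/andP[cc c3] Lc].
rewrite cat_uniq count_cat doubleS => /and3P[_ _ /(IH Lc)].
suff c2 : 2 <= count in_clique q by rewrite -add2n; apply: leq_add.
(* If [x] is in the clique, the edge from [y] to [z] supplies a second clique vertex; otherwise [y]
   and the last vertex, both neighbours of [x], are in it. *)
case: q cc c3 => [|x [|y [|z q]]] //= /and3P[/andP[_ xy] /andP[_ yz] +] _.
have : in_clique (last z q) -> 0 < count in_clique (z :: q).
  by rewrite -has_count => lc; apply/hasP; exists (last z q); rewrite ?mem_last.
move=> + /[!rcons_path] /andP[_ /andP[_ lx]].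
case: (in_clique x) xy lx => [_ _ _|/= -> /[!orbF] -> /(_ isT) //].
by case: (in_clique y) yz => //= ->.
Qed.

(** Two clique vertices and one independent vertex at a time form a triangle. *)
Lemma triangle_packing n (ks ws : seq V) :
  size ks = n.*2 -> size ws = n -> all in_clique ks -> all (predC in_clique) ws ->
  uniq (ks ++ ws) ->
  exists L, [/\ packing clique_join L, perm_eq (flatten L) (ks ++ ws) & size L = n].
Proof.
elim: n ks ws => [|n IH] [|a [|b ks]] [|w ws] //=; first by exists [::].
move=> [sk] [sw] /and3P[Ka Kb Kks] /andP[Kw Kws] u0.
have {u0}u : uniq ((a :: b :: ks) ++ w :: ws) := u0.
have [|||||L [Lp Lf sL]] := IH ks ws => //.
  apply: subseq_uniq u.
  by apply: cat_subseq; [apply: (suffix_subseq [:: a; b])|apply: subseq_cons].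
have P : perm_eq ([:: a; b; w] ++ flatten L) (a :: b :: ks ++ w :: ws).
  by apply/permP => p; have /permP/(_ p) := Lf; rewrite /= !count_cat /=; lia.
exists ([:: a; b; w] :: L); split=> //=; last by rewrite sL.
rewrite packing_cons (perm_uniq P) u Lp /= !andbT /clique_join Ka Kb orbT !andbT.
have -> /= : a != b by move: u; rewrite /= inE negb_or => /andP[/andP[]].
rewrite /= in Kw.
rewrite orbT andbT; apply/andP; split; apply/eqP => E; move: Kw.
  by rewrite -E Kb.
by rewrite E Ka.
Qed.

(** Without [y] the clique has [f.*2] vertices, and without [u] and [v] at least [m - 1] of the
    [m.+1] independent vertices remain. As [f < m], this is enough for [f] triangles. *)
Lemma clique_join_packing (y u v : V) : in_clique y ->
  ~~ in_clique u -> ~~ in_clique v -> f < m ->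
  exists L, [/\ packing clique_join L, {in flatten L, forall x, x \notin [:: y; u; v]} &
    size L = f].
Proof.
move=> Ky Nu Nv fm.
pose K : seq V := [seq Some (inl i) | i <- enum 'I_c].
pose I : seq V := None :: [seq Some (inr i) | i <- enum 'I_m].
have Ku : uniq K by rewrite map_inj_uniq ?enum_uniq // => i j [].
have Iu : uniq I.
  rewrite /= map_inj_uniq ?enum_uniq ?andbT => [|i j [] //].
  by apply/mapP => -[].
have KK : all in_clique K by rewrite all_map; apply/allP.
have II : all (predC in_clique) I by rewrite /= all_map; apply/allP.
pose ks := filter (predC1 y) K.
pose ws := take f [seq w <- I | w \notin [:: u; v]].
have sk : size ks = f.*2.
  have := count_predC (pred1 y) K; rewrite (count_uniq_mem _ Ku).
  have -> : y \in K.
    by case: y Ky {ks} => [[i|]|] // _; apply/mapP; exists i; rewrite ?mem_enum.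
  by rewrite size_map size_enum_ord size_filter [RHS]cE => -[].
have sw : size ws = f.
  rewrite size_takel // size_filter.
  have := count_predC (mem [:: u; v]) I.
  have : size (filter (mem [:: u; v]) I) <= 2.
    apply: (@uniq_leq_size _ _ [:: u; v]); first exact: filter_uniq.
    by move=> x; rewrite mem_filter => /andP[].
  rewrite size_filter [size I]/= size_map size_enum_ord.
  by rewrite -[count (predC _) I]/(count (fun w => w \notin [:: u; v]) I); lia.
have Kks : all in_clique ks.
  by rewrite all_filter; apply: sub_all KK => x /= ->; rewrite implybT.
have wsP x : x \in ws -> ~~ in_clique x && (x \notin [:: u; v]).
  by move=> /mem_take; rewrite mem_filter => /andP[-> /(allP II) /= ->].
have Iws : all (predC in_clique) ws by apply/allP => x /wsP/andP[].
have u' : uniq (ks ++ ws).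
  rewrite cat_uniq filter_uniq // take_uniq ?filter_uniq // andbT /=.
  by apply/hasPn => x /wsP/andP[Nx _]; apply: contra Nx => /(allP Kks).
have [L [Lp Lf sL]] := triangle_packing sk sw Kks Iws u'.
exists L; split=> // x; rewrite (perm_mem Lf) mem_cat => /orP[xk|/wsP/andP[Nx xuv]].
  have Kx := allP Kks _ xk; move: xk; rewrite mem_filter => /andP[/= xy _].
  rewrite inE negb_or xy /= !inE; apply/norP; split; apply/eqP => E; move: Kx.
    by rewrite E (negPf Nu).
  by rewrite E (negPf Nv).
by rewrite inE negb_or xuv andbT; apply/eqP => E; rewrite E Ky in Nx.
Qed.

(** Nonadjacent vertices are independent, so a new edge forms a triangle with any clique vertex
    [k0], and [clique_join_packing] finds [f] more triangles. Root paths pass through at most one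
    clique vertex. *)
Lemma clique_join_good : f < m -> good f clique_join.
Proof.
move=> fm; have c0 : 0 < c by rewrite cE.
pose k0 : V := Some (inl (Ordinal c0)).
have NN : ~~ in_clique (None : V) by [].
have Kk0 : in_clique k0 by [].
have uniq_avoid (s t : seq V) L : packing clique_join L ->
    {in flatten L, forall x, x \notin t} -> uniq s -> {subset s <= t} ->
    uniq (s ++ flatten L).
  case/andP=> _ Lu Lt su st; rewrite cat_uniq su Lu andbT /=.
  by apply/hasPn => x /Lt; apply: contra => /st.
split.
- by move=> x y; rewrite /clique_join eq_sym orbC.
- by move=> x; rewrite /clique_join eqxx.
- exact: clique_join_le.
- move=> u v uv; rewrite /clique_join uv negb_or => /andP[Nu Nv].
  have [L [Lp La sL]] := clique_join_packing Kk0 Nu Nv fm.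
  exists ([:: u; v; k0] :: L); last by rewrite /= sL.
  apply: packing_edge => //.
    rewrite /= /clique_join !orbT !andbT; apply/andP; split.
      by apply/eqP => E; rewrite E in Nv.
    by apply/eqP => E; rewrite -E in Nu.
  apply: (uniq_avoid [:: u; v; k0] _ _ Lp La) => [|x].
    rewrite /= !inE negb_or uv /= andbT; apply/andP; split; apply/eqP => E.
      by rewrite E in Nu.
    by rewrite E in Nv.
  by rewrite !inE => /or3P[]->; rewrite ?orbT.
- move=> u; have [Ku|Nu] := boolP (in_clique u).
    have [L [Lp La sL]] := clique_join_packing Ku NN NN fm.
    have u0 : None != u by apply/eqP => E; rewrite -E in Ku.
    exists [:: u], L; split=> //; first by rewrite /= /clique_join u0 Ku orbT.
    apply: (uniq_avoid [:: None; u] _ _ Lp La) => [|x]; first by rewrite /= inE u0.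
    by rewrite !inE => /orP[]->; rewrite ?orbT.
  have [L [Lp La sL]] := clique_join_packing Kk0 Nu NN fm.
  have [u0|u0] := eqVneq u None.
    exists [::], L; split=> //; apply: (uniq_avoid [:: None] _ _ Lp La) => // x.
    by rewrite !inE => ->; rewrite !orbT.
  have ku : k0 != u by apply/eqP => E; rewrite -E in Nu.
  exists [:: k0; u], L; split=> //; first by rewrite /= /clique_join ku.
  apply: (uniq_avoid [:: None; k0; u] _ _ Lp La) => [|x].
    by rewrite /= !inE ku negb_or [None == u]eq_sym u0.
  by rewrite !inE => /or3P[]->; rewrite ?orbT.
Qed.
End CliqueJoin.

Lemma realizable_clique_join f N : 3 * f + 2 <= N ->
  realizable f N (f.*2.+1 * (N - f)).
Proof.
move=> fN; pose m := N - f.*2.+1.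
exists ('I_f.*2.+1 + 'I_m)%type, (@clique_join f.*2.+1 m); split.
- by rewrite card_sum !card_ord /m; lia.
- by apply: clique_join_good => //; rewrite /m; lia.
- by rewrite (clique_join_sum m erefl); congr (_ * _).*2; rewrite /m; lia.
Qed.

(** * Wheels *)

Lemma cycle_two_neighbors (T : eqType) (e : rel T) c x : symmetric e ->
  cycle e c -> 2 < size c -> uniq c -> x \in c ->
  exists y z, [/\ y \in c, z \in c, y != z, e x y & e x z].
Proof.
move=> es cc c3 cu /rot_to[i q rq].
move: c3 cc cu; rewrite -(size_rot i) -(rot_cycle i) -(rot_uniq i) rq.
have mc y : y \in x :: q -> y \in c by rewrite -rq mem_rot.
case: q {rq} => [|y q] // in mc *; case/lastP: q => [|q z] // in mc * => _ cc cu.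
exists y, z; split.
- by apply: mc; rewrite !inE eqxx orbT.
- by apply: mc; rewrite !inE mem_rcons mem_head !orbT.
- by move: cu => /= /and3P[_ + _]; apply: contraNneq => ->; rewrite mem_rcons mem_head.
- by case/andP: cc.
- by move: cc; rewrite /= rcons_path last_rcons [e z x]es => /and3P[].
Qed.

Section Wheel.
Variable s : nat.
Let V := option ('I_6 + 'I_s).

(* The hub has label 0, the rim vertices have labels 1 to 5, and the [s.+1]
   vertices of label 6, one of which is the root, are joined to 0 and 1 only. *)
Definition label (x : V) : nat := if x is Some (inl i) then i else 6.

Definition label_rel (a b : nat) : bool :=
  let E := [:: (0, 1); (0, 2); (0, 3); (0, 4); (0, 5); (0, 6);
               (1, 2); (2, 3); (3, 4); (4, 5); (5, 1); (6, 1)] in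
  ((a, b) \in E) || ((b, a) \in E).

Definition wheel : rel V := relpre label label_rel.

Lemma label_le x : label x <= 6.
Proof. by case: x => [[i|]|] //=; apply: ltnW. Qed.

Lemma label_inj x y : label x = label y -> label x != 6 -> x = y.
Proof.
case: x y => [[i|i]|] [[j|j]|] //= ij; rewrite ?ij // => n6.
by rewrite (ord_inj ij).
Qed.

Lemma wheel_sym : symmetric wheel.
Proof. by move=> x y; rewrite /wheel /= /label_rel orbC. Qed.

Lemma wheel_irr : irreflexive wheel.
Proof.
by move=> x; rewrite /wheel /=; case: (label x) (label_le x) => [|[|[|[|[|[|[|]]]]]]].
Qed.

Lemma wheel_sum : \sum_x \sum_y wheel x y = (2 * (s + 6)).*2.
Proof.
rewrite big_option big_sumType !big_ord_recl big_ord0 /=.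
have E x : \sum_y wheel x y = label_rel (label x) 6 * s.+1 +
    \sum_(i < 6) label_rel (label x) i.
  have -> : label_rel (label x) 6 * s.+1 =
      wheel x None + \sum_(i < s) wheel x (Some (inr i)).
    rewrite (eq_bigr (fun=> label_rel (label x) 6 : nat)) //.
    by rewrite sum_nat_const card_ord mulnS mulnC.
  by rewrite big_option big_sumType addnAC addnA.
rewrite [X in _ + (_ + X)](eq_bigr (fun=> 2)); last first.
  by move=> i _; rewrite E !big_ord_recl big_ord0.
by rewrite !E sum_nat_const card_ord /= !big_ord_recl !big_ord0 /=; lia.
Qed.

(* Labels other than 6 determine the vertex, so the label set of a cycle is
   closed in this sense, and only finitely many label sets are to be checked. *)
Definition label_closed (S : pred nat) := all (fun a => S a ==>
  has (fun p => [&& S p.1, S p.2, (p.1 != p.2) || (p.1 == 6),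
    label_rel a p.1 & label_rel a p.2]) [seq (x, y) | x <- iota 0 7, y <- iota 0 7])
  (iota 0 7).

Lemma label_closed_core (S : pred nat) :
  label_closed S -> has S (iota 0 7) ->
  has S (iota 1 5) && (~~ S 0 ==> all S (iota 1 5)).
Proof.
(* Only the values of [S] at the seven labels matter; tabulating them leaves 128 cases to
   compute. *)
pose S' := nth false (map S (iota 0 7)).
have E : {in iota 0 7, S =1 S'}.
  by move=> a; rewrite mem_iota => a7; rewrite /S' (nth_map 0) ?size_iota ?nth_iota.
have -> : label_closed S = label_closed S'.
  apply: eq_in_all => a a7; rewrite E //; congr (_ ==> _).
rewrite (eq_in_has E) (E 0) // (@eq_in_has _ S S' (iota 1 5)); last first.
  by move=> a /[!mem_iota] a5; apply: E; rewrite mem_iota; lia.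
rewrite (@eq_in_all _ S S' (iota 1 5)); last first.
  by move=> a /[!mem_iota] a5; apply: E; rewrite mem_iota; lia.
rewrite {E}/S' /map /iota.
by case: (S 0); case: (S 1); case: (S 2); case: (S 3); case: (S 4); case: (S 5);
  case: (S 6); vm_compute.
Qed.

(** Each vertex of a cycle has two distinct neighbours on it, and these can share a label only if
    that label is 6; hence the label set is closed. *)
Lemma wheel_cycle c : cycle wheel c -> 2 < size c -> uniq c ->
  has (mem (map label c)) (iota 1 5) /\
  (0 \notin map label c -> {subset iota 1 5 <= map label c}).
Proof.
move=> cc c3 cu.
pose S a := a \in map label c.
have Sle x : x \in c -> label x \in iota 0 7 by rewrite mem_iota ltnS label_le.
suff /label_closed_core : label_closed S.
  case/(_ _)/andP => [|hS /implyP aS]; last by split=> // /aS/allP.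
  case: c c3 Sle @S {cc cu} => // x c _ Sle S.
  by apply/hasP; exists (label x); rewrite ?Sle ?mem_head // /S map_f ?mem_head.
apply/allP => a _; apply/implyP => /mapP[x xc ->].
have [y [z [yc zc yz xy xz]]] := cycle_two_neighbors wheel_sym cc c3 cu xc.
apply/hasP; exists (label y, label z).
  by apply/allpairsP; exists (label y, label z); rewrite !Sle.
apply/and5P; split; [exact: map_f|exact: map_f| |exact: xy|exact: xz].
have [y6|y6] := eqVneq (label y) 6; first by rewrite /= y6 orbT.
by apply/orP; left; apply: contraNneq yz => /label_inj ->.
Qed.

(** Disjoint cycles cannot both contain the hub. One that misses it covers the whole rim and so
    meets any other cycle, which has a rim vertex. *)
Lemma wheel_le L : packing wheel L -> size L <= 1.
Proof.
case: L => [|c [|d L]] //.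
have common x y c' d' : x \in c' -> y \in d' -> label x = label y ->
    label x < 6 -> uniq (c' ++ d') -> False.
  move=> xc yd xy x6; rewrite cat_uniq => /and3P[_ /hasPn/(_ y yd) /negP+ _]; apply.
  by rewrite -(label_inj xy) // neq_ltn x6.
rewrite !packing_cons => /and4P[cc c3 cu /and4P[dc d3 du _]].
have {cu}cdu : uniq (c ++ d) by move: cu; rewrite /= catA cat_uniq => /andP[].
have {du}du : uniq d by move: du; rewrite cat_uniq => /andP[].
have cu : uniq c by move: cdu; rewrite cat_uniq => /andP[].
have [/hasP[a ha aS] c0] := wheel_cycle cc c3 cu.
have [/hasP[b hb bS] d0] := wheel_cycle dc d3 du.
exfalso; have [c0'|/c0 cS] := boolP (0 \in map label c); last first.
  have /mapP[x xc ex] := cS _ hb; have /mapP[y yd ey] := bS.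
  apply: (common x y c d) => //; rewrite -?ex //.
  by move: hb; rewrite mem_iota => /andP[].
have [d0'|/d0 dS] := boolP (0 \in map label d); last first.
  have /mapP[x xc ex] := aS; have /mapP[y yd ey] := dS _ ha.
  apply: (common x y c d) => //; rewrite -?ex //.
  by move: ha; rewrite mem_iota => /andP[].
have /mapP[x xc ex] := c0'; have /mapP[y yd ey] := d0'.
by apply: (common x y c d) => //; rewrite -?ex.
Qed.

Let h : V := Some (inl (@Ordinal 6 0 isT)).
Let v1 : V := Some (inl (@Ordinal 6 1 isT)).
Let v2 : V := Some (inl (@Ordinal 6 2 isT)).
Let v3 : V := Some (inl (@Ordinal 6 3 isT)).
Let v4 : V := Some (inl (@Ordinal 6 4 isT)).
Let v5 : V := Some (inl (@Ordinal 6 5 isT)).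

(** The new edge closes a cycle along a rim path that avoids the hub, and two adjacent rim vertices
    left over form a triangle with the hub. Ordering the labels halves the cases. *)
Lemma wheel_add_le (u v : V) : u != v -> ~~ wheel u v -> label u <= label v ->
  exists p c, [/\ path wheel v (rcons p u), 0 < size p,
    cycle wheel c && (2 < size c) & uniq (u :: v :: p ++ c)].
Proof.
case: u => [[[i ip]|i]|]; case: v => [[[j jp]|j]|] uv Nuv luv;
  rewrite /= in luv; try by rewrite leqNgt jp in luv.
- move: uv Nuv luv; case: i ip => [|[|[|[|[|[|i]]]]]] ip // ;
    case: j jp => [|[|[|[|[|[|j]]]]]] jp // _ _ _.
  + by exists [:: v2], [:: h; v4; v5].
  + by exists [:: v5], [:: h; v2; v3].
  + by exists [:: v3], [:: h; v1; v5].
  + by exists [:: v1], [:: h; v3; v4].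
  + by exists [:: v4], [:: h; v1; v2].
- move: uv Nuv {luv}; case: i ip => [|[|[|[|[|[|i]]]]]] ip // _ _.
  + by exists [:: v1], [:: h; v3; v4].
  + by exists [:: v1; v2], [:: h; v4; v5].
  + by exists [:: v1; v5], [:: h; v2; v3].
  + by exists [:: v1], [:: h; v2; v3].
- move: uv Nuv {luv}; case: i ip => [|[|[|[|[|[|i]]]]]] ip // _ _.
  + by exists [:: v1], [:: h; v3; v4].
  + by exists [:: v1; v2], [:: h; v4; v5].
  + by exists [:: v1; v5], [:: h; v2; v3].
  + by exists [:: v1], [:: h; v2; v3].
(* Both ends have label 6, the root included. *)
all: exists [:: v1], [:: h; v2; v3]; split=> //.
by move: uv; rewrite /= !inE => /negPf->.
Qed.

Lemma wheel_good : good 1 wheel.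
Proof.
split; [exact: wheel_sym|exact: wheel_irr|exact: wheel_le| |].
- move=> u v; wlog luv : u v / label u <= label v => [W uv Nuv|uv Nuv].
    have [/W|/ltnW/W] := leqP (label u) (label v); first exact.
    rewrite eq_sym wheel_sym => /(_ uv Nuv)[L Lp sL]; exists L => //.
    by apply: sub_packing Lp => x y; rewrite addrelC.
  have [p [c [pu p0 cp cu]]] := wheel_add_le uv Nuv luv.
  exists [:: u :: v :: p; c] => //; apply: packing_edge => //=.
    rewrite packing1 andbA cp.
    by move: cu => /= /and3P[_ _]; rewrite cat_uniq => /and3P[].
  by move: cu; rewrite cats0.
- have ex p c u : path wheel None p -> last None p = u ->
      cycle wheel c && (2 < size c) -> uniq (None :: p ++ c) ->
      exists p L, [/\ path wheel None p, last None p = u, packing wheel L,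
        uniq (None :: p ++ flatten L) & size L = 1].
    move=> pp lp cp pu; exists p, [:: c]; split; rewrite ?[flatten _]cats0 //.
    rewrite packing1 andbA cp.
    by move: pu => /= /andP[_]; rewrite cat_uniq => /and3P[].
  case=> [[[i ip]|i]|].
  + case: i ip => [|[|[|[|[|[|i]]]]]] ip //.
    * exact: (ex [:: Some (inl (Ordinal ip))] [:: v1; v2; v3; v4; v5]).
    * exact: (ex [:: Some (inl (Ordinal ip))] [:: h; v2; v3]).
    * exact: (ex [:: v1; Some (inl (Ordinal ip))] [:: h; v3; v4]).
    * exact: (ex [:: v1; v2; Some (inl (Ordinal ip))] [:: h; v4; v5]).
    * exact: (ex [:: v1; v5; Some (inl (Ordinal ip))] [:: h; v2; v3]).
    * exact: (ex [:: v1; Some (inl (Ordinal ip))] [:: h; v2; v3]).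
  + exact: (ex [:: h; Some (inr i)] [:: v1; v2; v3; v4; v5]).
  + exact: (ex [::] [:: v1; v2; v3; v4; v5]).
Qed.
End Wheel.

Lemma realizable_wheel N : 6 <= N -> realizable 1 N (2 * N).
Proof.
move=> N6; exists ('I_6 + 'I_(N - 6))%type, (@wheel (N - 6)); split.
- by rewrite card_sum !card_ord subnKC.
- exact: wheel_good.
- by rewrite wheel_sum subnK.
Qed.

(** * Arithmetic of the blocks *)

Lemma realizable_eq f N m f' N' m' :
  realizable f N m -> f = f' -> N = N' -> m = m' -> realizable f' N' m'.
Proof. by move=> + <- <- <-. Qed.

Lemma realizable0 : realizable 0 0 0.
Proof.
exists void, (fun _ _ => false); split; first exact: card_void.
  split=> //; last by case=> [[]|]; exists [::], [::].
    move=> L /packing_size; rewrite card_option card_void.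
    by rewrite leqn0.
  by case=> [[]|] [[]|].
by rewrite big1 // => x _; rewrite big1.
Qed.

Lemma realizable_mul a f N m : realizable f N m ->
  realizable (a * f) (a * N) (a * m).
Proof.
move=> R; elim: a => [|a IH]; first exact: realizable0.
by rewrite !mulSn; apply: realizable_add.
Qed.

Lemma realizable_pendant w f N m : realizable f N m ->
  realizable f (N + w) (m + w).
Proof.
move=> R; apply: (realizable_eq (realizable_add R (realizable_mul w realizable_K2))).
all: by rewrite ?muln0 ?muln1 ?addn0.
Qed.

(** Count edges in excess of non-root vertices: a pendant edge gives 0, a [K_5] gives 6, and a wheel
    on [z] non-root vertices gives [z]. The excess [m - N] thus dictates [z] once [a] copies of
    [K_5] are fixed. *)
Lemma realizable_sparse a N m : 4 * a + 6 <= N -> N + 6 * a + 6 <= m ->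
  m <= 2 * N + 2 * a -> realizable a.+1 N m.
Proof.
move=> aN Nm mN; pose z := m - N - 6 * a.
have z6 : 6 <= z by rewrite /z; lia.
apply: (realizable_eq (realizable_pendant (N - 4 * a - z)
  (realizable_add (realizable_mul a realizable_K5) (realizable_wheel z6)))).
all: rewrite /z; lia.
Qed.

(** Successive intervals leave no gap; this selects the size of a block from the desired number of
    edges. *)
Lemma interval_cover (lo hi : nat -> nat) a b m : a <= b ->
  (forall j, a <= j < b -> lo j.+1 <= (hi j).+1) -> lo a <= m <= hi b ->
  exists2 j, a <= j <= b & lo j <= m <= hi j.
Proof.
move=> ab step /andP[am mb].
elim: b ab step mb => [|b IH] ab step mb.
  have a0 : a = 0 by lia.
  by exists 0; rewrite ?a0 // mb -a0 am.
have [mlo|lom] := ltnP m (lo b.+1); last by exists b.+1; rewrite ?ab ?lom ?mb ?leqnn.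
have [ab'|ab'] := leqP a b; last first.
  have aE : a = b.+1 by lia.
  by rewrite aE leqNgt mlo in am.
have mb' : m <= hi b by have := step b; rewrite ab' ltnSn => /(_ isT); lia.
have [|j ajb jm] := IH ab' _ mb'; first by move=> j jb; apply: step; lia.
by exists j => //; lia.
Qed.

Lemma realizable_mid a N m : 0 < a -> 5 * a + 6 <= N -> N + 7 * a + 6 <= m ->
  m + 3 * a + 6 <= 3 * N -> realizable a.+1 N m.
Proof.
move=> a0 aN Nm mN.
(* For fixed [x] the number of edges is [N + 2 * x - 3 * a + z], where the wheel size [z] ranges
   from 6 to [N - x]. Each join needs 5 non-root vertices, hence [5 * a] at the lower end. *)
have [|||x ax xm] := @interval_cover (fun x => N + 2 * x + 6 - 3 * a)
  (fun x => 2 * N + x - 3 * a) (5 * a) (N - 6) m; [lia|by move=> j; lia|lia|].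
pose z := m + 3 * a - N - 2 * x.
(* [x] non-root vertices lie in [a] joins of a triangle with independent
   vertices, [z] in the wheel, and the others are pendant. *)
have z6 : 6 <= z by rewrite /z; lia.
have y5 : 3 * 1 + 2 <= x - 5 * a.-1 by lia.
have c5 := @realizable_clique_join 1 5 isT.
apply: (realizable_eq (realizable_pendant (N - x - z)
  (realizable_add (realizable_add (realizable_mul a.-1 c5)
    (realizable_clique_join y5)) (realizable_wheel z6)))).
all: rewrite /z; lia.
Qed.

(** One large join on [j] non-root vertices has packing number [a] and sets the slope [2 * a + 1]; a
    graph from [realizable_mid] on the other [N - j] adds packing number 2 and fills the gaps
    between successive [j]. *)
Lemma realizable_dense a N m : 2 <= a -> 5 * a + 10 <= N ->
  2 * N + 4 * (a * a) <= m ->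
  m + 6 * (a * a) + 13 * a <= (2 * a + 1) * N + 7 -> realizable a.+2 N m.
Proof.
move=> a2 aN Nm mN.
(* The range of [j] starts at the least size of a join. Stopping at [N - 2 * a - 8] keeps the
   remainder large enough for successive intervals to meet. *)
have [|||j aj jm] := @interval_cover
  (fun j => (2 * a + 1) * (j - a) + (N - j) + 13)
  (fun j => (2 * a + 1) * (j - a) + 3 * (N - j) - 9) (3 * a + 2) (N - 2 * a - 8) m.
- lia.
- move=> j ajN; rewrite subSn; last by lia.
  rewrite mulnS; lia.
- have -> : 3 * a + 2 - a = 2 * a + 2 by lia.
  have -> : N - 2 * a - 8 - a = N - (3 * a + 8) by lia.
  rewrite mulnBr; nia.
have j3 : 3 * a + 2 <= j by lia.
have R := @realizable_mid 1 (N - j) (m - (2 * a + 1) * (j - a)) isT.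
apply: (realizable_eq (realizable_add (realizable_clique_join j3) (R _ _ _))).
all: rewrite -?muln2; lia.
Qed.

(** * The five ranges of edge numbers *)

Local Open Scope classical_set_scope.
Local Open Scope ring_scope.

Theorem theorem2p3 :
  (forall k n : nat, (2 <= k)%N -> (maxn (3 * k) (4 * k - 3) <= n)%N ->
     (sat n k)%:Z <= n%:Z + 6 * k%:Z - 7)
  /\
  (forall k n : nat, (2 <= k)%N -> (4 * k - 1 <= n)%N ->
     `[n%:Z + 6 * k%:Z - 7, 2 * n%:Z + 2 * k%:Z - 6] `<=` Posz @` ES n k)
  /\
  (forall k n : nat, (3 <= k)%N -> (5 * k - 1 <= n)%N ->
     `[n%:Z + 6 * k%:Z - 7, 3 * n%:Z - 3 * k%:Z - 3] `<=` Posz @` ES n k)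
  /\
  (forall k n : nat, (5 <= k)%N -> (5 * k - 4 <= n)%N ->
     `[2 * n%:Z + 4 * k%:Z ^+ 2 - 24 * k%:Z + 34,
       (2 * k%:Z - 5) * n%:Z - 6 * k%:Z ^+ 2 + 21 * k%:Z - 3]
       `<=` Posz @` ES n k)
  /\
  (forall k n : nat, (2 <= k)%N -> (3 * k <= n)%N ->
     [set n%:Z - 2 * k%:Z ^+ 2 + k%:Z + (2 * k%:Z - 2) * t
       | t in `[3 * k%:Z, n%:Z]] `<=` Posz @` ES n k).
Proof.
have to_ES k n (z : int) : (0 < k)%N -> (0 < n)%N -> 0 <= z ->
    realizable k.-1 n.-1 `|z|%N -> (Posz @` ES n k) z.
  case: k n => [|k] [|n] // _ _ z0 R.
  by exists `|z|%N; [apply: realizable_ES|rewrite gez0_abs].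
have itvP' (a b z : int) : [set` `[a, b]] z -> a <= z /\ z <= b.
  by rewrite /= in_itv /= => /andP[].
split; last split; last split; last split.
- move=> [|k] n // k2; rewrite geq_max => /andP[n3 n4].
  (* Here [k] copies of [K_5] and pendant edges suffice, without a wheel. *)
  have R : realizable k n.-1 (n + 6 * k.+1 - 7)%N.
    apply: (realizable_eq (realizable_pendant (n.-1 - 4 * k)
      (realizable_mul k realizable_K5))); lia.
  have E : ES n k.+1 (n + 6 * k.+1 - 7)%N.
    have := realizable_ES R; rewrite prednK //; lia.
  have := (Defs.satP n (ltn0Sn k)).2 _ E; lia.
- move=> k n k2 n4 z /itvP'[lz zu]; apply: to_ES; [lia|lia|lia|].
  rewrite (_ : k.-1 = (k - 2).+1)%N; last by lia.
  apply: realizable_sparse; lia.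
- move=> k n k3 n5 z /itvP'[lz zu]; apply: to_ES; [lia|lia|lia|].
  rewrite (_ : k.-1 = (k - 2).+1)%N; last by lia.
  (* Up to the bound of the previous item the sparse construction applies; the range of
     [realizable_mid] starts no later than just above it. *)
  have [zs|sz] := leP z (2 * n%:Z + 2 * k%:Z - 6).
    apply: realizable_sparse; lia.
  apply: realizable_mid; lia.
- move=> k n k5 n5 z /itvP'[lz zu].
  have [a [N [kE nE a2]]] : exists a N : nat, [/\ k = (a + 3)%N, n = N.+1 & (2 <= a)%N].
    by exists (k - 3)%N, n.-1; split; lia.
  subst k n; apply: to_ES; [lia|lia|nia|].
  rewrite (_ : (a + 3).-1 = a.+2)%N /=; last by lia.
  apply: realizable_dense; [lia|lia| |]; nia.
- move=> k n k2 n3 z [t /itvP'[lt tu] <-].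
  have [a [u [kE tE]]] : exists a u : nat, k = a.+1 /\ t = u.+1.
    by exists k.-1, (`|t|%N).-1; split; lia.
  have [w nE] : exists w : nat, n = (u.+1 + w)%N by exists (n - u.+1)%N; lia.
  subst k t n.
  have au : (3 * a + 2 <= u)%N by lia.
  have [v uE] : exists v : nat, u = (a + v)%N by exists (u - a)%N; lia.
  (* A join on [t] vertices, root included, with [n - t] pendant edges: one more vertex in the join
     replaces a pendant edge by [2 * k - 1] edges, which gives the step [2 * k - 2]. *)
  have R := realizable_pendant w (realizable_clique_join au).
  apply: to_ES; [lia|lia|subst u; nia|].
  apply: (realizable_eq R); [lia|lia|subst u; nia].
Qed.
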